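(* If $q\in\{16,17,\dots,40\}$, then $\operatorname{achr}(K_6\square K_q)\ge 2q+4$.
   Context: For a finite simple graph $G$, $\operatorname{achr}(G)$ (the achromatic number) is the maximum number of colours in a proper vertex colouring of $G$ that is complete, i.e. every pair of distinct colours appears on the two ends of some edge. $K_6\square K_q$ is the Cartesian product of the complete graphs $K_6$ and $K_q$ (vertex set $[1,6]\times[1,q]$, two vertices adjacent iff they agree in exactly one coordinate). *)

(* Defs.v *)
From mathcomp Require Import all_boot.

Set Implicit Arguments.
Unset Strict Implicit.
Unset Printing Implicit Defensive.

Record sgraph := SGraph {
  vertex :> finType;
  adj : rel vertex;
  adj_sym : symmetric adj;
  adj_irrefl : irreflexive adj
}.

Section Complete.
Variable n : nat.
Definition complete_adj : rel 'I_n := fun x y => x != y.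
Lemma complete_adj_sym : symmetric complete_adj.
Proof. by move=> x y; rewrite /complete_adj eq_sym. Qed.
Lemma complete_adj_irrefl : irreflexive complete_adj.
Proof. by move=> x; rewrite /complete_adj eqxx. Qed.
Definition complete_graph : sgraph :=
  SGraph complete_adj_sym complete_adj_irrefl.
End Complete.

Section Cartesian.
Variables G H : sgraph.
Definition cartesian_adj : rel (G * H)%type := fun x y =>
  (x.1 == y.1) && adj x.2 y.2 || adj x.1 y.1 && (x.2 == y.2).
Lemma cartesian_adj_sym : symmetric cartesian_adj.
Proof.
move=> x y; rewrite /cartesian_adj (eq_sym x.1) (eq_sym x.2).
by rewrite (adj_sym x.1) (adj_sym x.2).
Qed.
Lemma cartesian_adj_irrefl : irreflexive cartesian_adj.
Proof. by move=> x; rewrite /cartesian_adj !adj_irrefl andbF. Qed.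
Definition cartesian_product : sgraph :=
  SGraph cartesian_adj_sym cartesian_adj_irrefl.
End Cartesian.

Lemma adj_cartesian_complete m n
    (x y : cartesian_product (complete_graph m) (complete_graph n)) :
  adj x y = (x.1 == y.1) (+) (x.2 == y.2).
Proof.
rewrite /= /cartesian_adj /= /complete_adj.
by case: (x.1 == y.1); case: (x.2 == y.2).
Qed.

Section Achromatic.
Variable G : sgraph.

Definition proper_colouring k (f : {ffun G -> 'I_k}) : bool :=
  [forall x, forall y, adj x y ==> (f x != f y)].

Definition complete_colouring k (f : {ffun G -> 'I_k}) : bool :=
  [forall i, forall j, (i != j) ==>
    [exists x, exists y, [&& adj x y, f x == i & f y == j]]].

(* Surjectivity says that exactly k colours are used; it is implied by
   completeness except when k = 1. *)
Definition has_complete_colouring k : bool :=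
  [exists f : {ffun G -> 'I_k},
    [&& proper_colouring f, complete_colouring f & [forall i, i \in codom f]]].

Definition achr : nat := \max_(k < #|G|.+1 | has_complete_colouring k) k.

Lemma has_complete_colouring_card k : has_complete_colouring k -> k <= #|G|.
Proof.
case/existsP=> f /and3P[_ _ /forallP fS].
rewrite -[X in X <= _](card_ord k) -(size_codom f).
apply: leq_trans (card_size (codom f)).
by apply/subset_leq_card/subsetP=> i _; apply: fS.
Qed.

Lemma leq_achr k : has_complete_colouring k -> k <= achr.
Proof.
move=> hk; have lt_k : k < #|G|.+1 by apply: has_complete_colouring_card.
exact: (leq_bigmax_cond (F := @nat_of_ord _) (Ordinal lt_k) hk).
Qed.

Lemma achr_attained : 0 < achr -> has_complete_colouring achr.
Proof.
move=> achr_gt0; have [k hk def_achr] :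
    {k : 'I_#|G|.+1 | has_complete_colouring k & achr = k}.
  apply: eq_bigmax_cond; rewrite lt0n; apply: contraTneq achr_gt0 => /card0_eq no.
  by rewrite /achr big_pred0.
by rewrite def_achr.
Qed.

End Achromatic.

(* Main.v *)
Require Import Defs.
From mathcomp Require Import all_boot.

(** Pair up the six rows as {0,1}, {2,3}, {4,5}.

    Twelve colours of frequency 2 fill four columns, indexed by (Z/2)^2: the
    four colours of the p-th pair of rows are also indexed by (Z/2)^2, colour x
    lying in column x of row 2p and in column x + v_p of row 2p + 1, where
    v_0, v_1, v_2 are the nonzero vectors.  Since v_p <> v_p', the two columns
    of a colour of the p-th pair contain all four colours of the p'-th pair.

    The other columns carry colours of frequency 3 having one cell in each pair
    of rows, so that they share a row with each of the twelve colours above.  Two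
    such colours share a row unless their row sets are complementary.  There are
    four pairs of complementary row sets.  Each pair gets its own block of s
    columns, with s colours for each of the two row sets: modulo s, the
    i-th colour of one row set occupies the columns i + d, d in {0, 1, 2}, and
    the j-th colour of the other the columns j + e, e in {0, 3, min(6, s - 1)}.
    For 6 <= s <= 9 the differences e - d exhaust Z/s, hence these
    colours share columns.  This uses 12 + 2(q - 4) = 2q + 4 colours, and q - 4
    is a sum of at most four block sizes between 6 and 9 when 16 <= q <= 40. *)

Section ColouringMatrix.
Variables (m n k : nat) (M : seq (seq nat)).

Definition entry (r c : nat) : nat := nth 0 (nth [::] M r) c.

Definition matrix_lines : seq (seq nat) :=
  [seq mkseq (entry r) n | r <- iota 0 m] ++
  [seq mkseq (entry^~ c) m | c <- iota 0 n].

(* The pairs (i, i) are included, which makes every colour occur. *)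
Definition complete_colouring_matrix : bool :=
  let ls := matrix_lines in
  [&& all uniq ls, all (all (ltn^~ k)) ls &
      all (fun i => let s := flatten [seq l <- ls | i \in l] in
                    all (fun j => j \in s) (iota 0 k)) (iota 0 k)].

Let G := cartesian_product (complete_graph m) (complete_graph n).

Lemma matrix_linesP (l : seq nat) :
  reflect ((exists2 r, r < m & l = mkseq (entry r) n) \/
           (exists2 c, c < n & l = mkseq (entry^~ c) m))
          (l \in matrix_lines).
Proof.
rewrite mem_cat; apply: (iffP orP) => -[].
- by case/mapP=> r; rewrite mem_iota => lt_r ->; left; exists r.
- by case/mapP=> c; rewrite mem_iota => lt_c ->; right; exists c.
- by case=> r lt_r ->; left; apply: map_f; rewrite mem_iota.
- by case=> c lt_c ->; right; apply: map_f; rewrite mem_iota.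
Qed.

Lemma complete_colouring_matrix_achr :
  complete_colouring_matrix -> k <= achr G.
Proof.
case/and3P=> /allP uniq_lines /allP lt_lines /allP meet_lines.
have row_in (x : G) : mkseq (entry x.1) n \in matrix_lines.
  by apply/matrix_linesP; left; exists (x.1 : nat).
have col_in (x : G) : mkseq (entry^~ x.2) m \in matrix_lines.
  by apply/matrix_linesP; right; exists (x.2 : nat).
have lt_entry (x : G) : entry x.1 x.2 < k.
  apply: (allP (lt_lines _ (row_in x))).
  by apply: map_f; rewrite mem_iota ltn_ord.
pose f : {ffun G -> 'I_k} := [ffun x => Ordinal (lt_entry x)].
have f_val x : f x = entry x.1 x.2 :> nat by rewrite ffunE.
(* Allowing x = y makes the case i = j available, which gives surjectivity. *)
have meet (i j : 'I_k) : exists x y : G,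
    [/\ (x.1 == y.1) || (x.2 == y.2), f x = i & f y = j].
  have /(meet_lines _)/allP/(_ j) : (i : nat) \in iota 0 k by rewrite mem_iota /=.
  rewrite mem_iota ltn_ord => /(_ isT) /flattenP[l].
  rewrite mem_filter => /andP[il /matrix_linesP[] [a lt_a def_l]] jl;
    move: il jl; rewrite def_l => /mapP[b b_n ib] /mapP[c c_n jc];
    move: b_n c_n; rewrite !mem_iota /= => lt_b lt_c.
  - exists (Ordinal lt_a, Ordinal lt_b), (Ordinal lt_a, Ordinal lt_c).
    by rewrite eqxx; split=> //; apply: val_inj; rewrite /= f_val.
  - exists (Ordinal lt_b, Ordinal lt_a), (Ordinal lt_c, Ordinal lt_a).
    by rewrite eqxx orbT; split=> //; apply: val_inj; rewrite /= f_val.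
apply: leq_achr; apply/existsP; exists f; apply/and3P; split.
- apply/forallP=> x; apply/forallP=> y; apply/implyP=> adj_xy.
  apply/negP=> /eqP/(congr1 val); rewrite /= !f_val => eq_xy.
  move: adj_xy; rewrite adj_cartesian_complete.
  have [xy1 | ne1] /= := eqVneq x.1 y.1.
    rewrite xy1 in eq_xy; case/eqP; apply: val_inj.
    by apply: (mkseq_uniqP _ _ (uniq_lines _ (row_in y))) => //; exact: ltn_ord.
  move/eqP=> xy2; rewrite xy2 in eq_xy; case/eqP: ne1; apply: val_inj.
  by apply: (mkseq_uniqP _ _ (uniq_lines _ (col_in y))) => //; exact: ltn_ord.
- apply/forallP=> i; apply/forallP=> j; apply/implyP=> ne_ij.
  have [x [y [line_xy fx fy]]] := meet i j.
  apply/existsP; exists x; apply/existsP; exists y.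
  rewrite fx fy !eqxx !andbT adj_cartesian_complete.
  case: eqVneq line_xy => [xy1 | _] //=; case: eqVneq => [xy2 | _] //= _.
  by rewrite -fx -fy [x]surjective_pairing xy1 xy2 -surjective_pairing eqxx in ne_ij.
- apply/forallP=> i; have [x [_ [_ <- _]]] := meet i i.
  exact: codom_f.
Qed.

End ColouringMatrix.

(** As few blocks of size at most 9 as possible, of nearly equal sizes; these sum to [w] by
    Hermite's identity. *)
Definition block_sizes (w : nat) : seq nat :=
  let b := (w + 8) %/ 9 in [seq (w + i) %/ b | i <- iota 0 b].

Definition xor4 (x y : nat) : nat :=
  nth 0 (nth [::] [:: [:: 0; 1; 2; 3]; [:: 1; 0; 3; 2];
                      [:: 2; 3; 0; 1]; [:: 3; 2; 1; 0]] x) y.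

(* The k-th row set contains row 2p + b iff b is the p-th entry. *)
Definition row_bits (k : nat) : seq bool :=
  nth [::] [:: [:: false; false; false]; [:: false; true; true];
               [:: true; false; true]; [:: true; true; false]] k.

(** [first] is the least colour of the block. Adding [s - d] subtracts [d] modulo [s] without
    truncation. *)
Fixpoint block_row (r k first : nat) (ss : seq nat) : seq nat :=
  if ss is s :: ss' then
    let d := nth 0 [:: 0; 1; 2] r./2 in
    let e := nth 0 [:: 0; 3; minn 6 s.-1] r./2 in
    [seq (if odd r == nth false (row_bits k) r./2
          then first + (c + (s - d)) %% s
          else first + s + (c + (s - e)) %% s) | c <- iota 0 s]
    ++ block_row r k.+1 (first + s.*2) ss'
  else [::].

(** In binary, [r./2.+1] is v_p, which is its own inverse. *)
Definition colour_row (q r : nat) : seq nat :=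
  [seq 4 * r./2 + (if odd r then xor4 c r./2.+1 else c) | c <- iota 0 4]
  ++ block_row r 0 12 (block_sizes (q - 4)).

Definition colour_matrix (q : nat) : seq (seq nat) := mkseq (colour_row q) 6.

Lemma colour_matrix_complete (q : nat) : 16 <= q <= 40 ->
  complete_colouring_matrix 6 q (2 * q + 4) (colour_matrix q).
Proof.
move=> hq.
pose P q := complete_colouring_matrix 6 q (2 * q + 4) (colour_matrix q).
suff /allP : all P (iota 16 25) by apply; rewrite mem_iota.
by vm_compute.
Qed.

Theorem proposition8 (q : nat) (hq : 16 <= q <= 40) :
  2 * q + 4 <= achr (cartesian_product (complete_graph 6) (complete_graph q)).
Proof.
exact: complete_colouring_matrix_achr (colour_matrix_complete q hq).
Qed.
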